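(* Let $K$ be a finite-dimensional regular CW complex with finitely many cells in each dimension. Let $\mathcal F(K)$ be its face poset, let $\widehat{\mathcal F}(K)$ be $\mathcal F(K)$ with a new minimum $\hat0$ and a new maximum $\hat1$ adjoined, and let $\mathcal{G}(K)$ be the Hasse diagram of $\widehat{\mathcal F}(K)$ viewed as a graph. Then there exist isomorphisms $$EMH_{k+2,\mathrm{rk}(\widehat{\mathcal F}(K))}(\hat0,\hat1)\;\cong\;H_k(\Delta(\mathcal F(K)))\;\cong\;MH_{k+2,\mathrm{rk}(\widehat{\mathcal F}(K))}(\hat0,\hat1),$$ where $\hat0,\hat1\in V(\mathcal G(K))$ are the vertices corresponding to $\hat0,\hat1\in\widehat{\mathcal F}(K)$, the (Eulerian) magnitude homology groups are those of the graph $\mathcal G(K)$, and $H_k$ is homology with integer coefficients.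
   Context: $\mathcal F(K)$ is the poset of closures of nonempty cells of $K$, ordered by inclusion. A poset is ranked of rank $n$ if all its maximal chains $a_0<a_1<\cdots<a_n$ have the same length $n$; $\mathrm{rk}$ denotes the rank. The Hasse diagram graph of a finite poset $Q$ is the undirected graph with vertex set $Q$ and an edge $\{a,b\}$ whenever $b$ covers $a$. $\Delta(Q)$ is the order complex of $Q$: its $n$-th chain group is the free abelian group on the chains $a_0<\cdots<a_n$ in $Q$, i.e. it is the simplicial complex whose $n$-simplices are these chains. For a finite graph $G$, $d(a,b)$ is the least number of edges in a walk from $a$ to $b$ ($\infty$ if none). A $k$-path is a tuple $(v_0,\dots,v_k)\in V(G)^{k+1}$ with $v_i\ne v_{i+1}$ and $d(v_i,v_{i+1})<\infty$ for $0\le i\le k-1$; its length is $\sum_{i=0}^{k-1}d(v_i,v_{i+1})$. It is Eulerian if its entries are pairwise distinct. For vertices $a,b$, $MC_{k,\ell}(a,b)$ is the free abelian group on $k$-paths of length $\ell$ with $v_0=a$, $v_k=b$; for $a\neq b$, $EMC_{k,\ell}(a,b)\subseteq MC_{k,\ell}(a,b)$ is generated by the Eulerian ones. The differential (lowering $k$ by one and preserving $\ell$) is $\partial=\sum_{i=1}^{k-1}(-1)^i\partial^i$, where $\partial^i(v_0,\dots,v_k)$ is the tuple with $v_i$ deleted if that tuple still has length $\ell$, and $0$ otherwise. $MH_{k,\ell}(a,b)$ and $EMH_{k,\ell}(a,b)$ are the resulting homology groups in degree $k$.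
   Formalization: The face poset with 0̂ and 1̂ adjoined is assumed ranked, so that rk is defined; for k = 0 the isomorphisms are with reduced H_0, since with unreduced H_0 the claim fails (K a point: both magnitude groups are 0 but H_0 = Z). For k ≥ 1 the isomorphisms are as stated. *)

(* Defs.v *)
From HB Require Import structures.
From mathcomp Require Import all_boot all_order all_algebra finmap.
From mathcomp Require Import all_classical all_reals all_analysis.

Set Implicit Arguments.
Unset Strict Implicit.
Unset Printing Implicit Defensive.

Import Order.TTheory GRing.Theory Num.Theory.
Import numFieldNormedType.Exports.

Local Open Scope ring_scope.

Definition zmod_isomorphic (A B : zmodType) : Prop :=
  exists f : {additive A -> B}, bijective f.

Section Homology.
Variables (A B C : zmodType) (f : {additive A -> B}) (g : {additive B -> C}).

Definition cycle_pred : {pred B} := [pred y | g y == 0].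

Lemma cycle_zmod_closed : zmod_closed cycle_pred.
Proof.
by split=> [|x y]; rewrite !inE ?raddf0// raddfB => /eqP-> /eqP->; rewrite subr0.
Qed.

HB.instance Definition _ :=
  GRing.isZmodClosed.Build B cycle_pred cycle_zmod_closed.

Definition cycles := {y : B | y \in cycle_pred}.
HB.instance Definition _ := SubChoice.on cycles.
HB.instance Definition _ := [SubChoice_isSubZmodule of cycles by <:].

Definition boundary_pred : {pred cycles} :=
  [pred y : cycles | `[< exists x : A, f x = val y >]].

Lemma boundary_zmod_closed : zmod_closed boundary_pred.
Proof.
split=> [|y z]; rewrite !inE; first by exists 0; rewrite !raddf0.
move=> [x xy] [t tz].
by exists (x - t); rewrite !raddfB /= xy tz.
Qed.

HB.instance Definition _ :=
  GRing.isZmodClosed.Build cycles boundary_pred boundary_zmod_closed.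

(* ker g / (im f :&: ker g), that is ker g / im f when g \o f = 0 *)
Definition homology : zmodType := Quotient.quot boundary_pred.

End Homology.

(* For S finite, the free abelian group on S is the group of functions
   S -> int. *)
Definition free_abelian (S : finType) : zmodType := {ffun S -> int}.

Definition basis_elt (S : finType) (s : S) : free_abelian S := [ffun t => (t == s)%:Z].

Section LinearExtension.
Variables (S : finType) (M : zmodType) (m : S -> M).

Definition linext (c : free_abelian S) : M := \sum_(s : S) m s *~ c s.

Lemma linext_zmod_morphism : zmod_morphism linext.
Proof.
move=> c d; rewrite /linext -sumrB; apply: eq_bigr => s _.
by rewrite !ffunE mulrzBr.
Qed.

HB.instance Definition _ :=
  GRing.isZmodMorphism.Build (free_abelian S) M linext linext_zmod_morphism.

End LinearExtension.

Section TupleComplex.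
Variables (V : finType).
(* [P n] selects the (n+1)-tuples spanning degree n; [I n] selects the
   positions deleted by the differential from degree n+1 to degree n. *)
Variables (P : forall n, pred (n.+1.-tuple V)) (I : forall n, pred 'I_n.+2).

Definition gens (n : nat) : finType := {t : n.+1.-tuple V | P t}.

Definition delete_at n (i : 'I_n.+2) (t : n.+2.-tuple V) : n.+1.-tuple V :=
  [tuple tnth t (lift i j) | j < n.+1].

(* The tuple with its i-th entry deleted if it is again a generator, and 0
   otherwise. *)
Definition face n (i : 'I_n.+2) (s : gens n.+1) : free_abelian (gens n) :=
  if insub (delete_at i (val s)) is Some t then basis_elt t else 0.

Definition bd n : {additive free_abelian (gens n.+1) -> free_abelian (gens n)} :=
  linext (fun s : gens n.+1 => \sum_(i < n.+2 | I i) face i s *~ (-1) ^+ i).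

Definition tuple_homology (k : nat) : zmodType :=
  if k is k'.+1 then homology (bd k'.+1) (bd k')
  else homology (bd 0) (\0 : {additive free_abelian (gens 0) -> int}).

(* Augmenting by the coefficient sum only affects degree 0. *)
Definition reduced_tuple_homology (k : nat) : zmodType :=
  if k is k'.+1 then homology (bd k'.+1) (bd k')
  else homology (bd 0) (linext (fun _ : gens 0 => 1 : int)).

End TupleComplex.

Section Magnitude.
Variables (V : finType) (e : rel V).

Definition has_walk (a b : V) (n : nat) : bool :=
  [exists p : n.-tuple V, path e a p && (last a p == b)].

(* [None] stands for infinity. *)
Definition dist (a b : V) : option nat :=
  if pselect (exists n, has_walk a b n) is left ex then Some (ex_minn ex)
  else None.

Definition is_kpath (s : seq V) : bool :=
  sorted (fun x y => (x != y) && isSome (dist x y)) s.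

(* Only used on sequences satisfying [is_kpath], where distances are finite. *)
Definition path_length (s : seq V) : nat :=
  (\sum_(xy <- zip s (behead s)) odflt 0 (dist xy.1 xy.2))%N.

Variables (l : nat) (a b : V).

Definition mag_gen k (t : k.+1.-tuple V) : bool :=
  [&& is_kpath t, path_length t == l, thead t == a & last a t == b].

Definition eulerian_mag_gen k (t : k.+1.-tuple V) : bool :=
  mag_gen t && uniq t.

Definition inner_position n : pred 'I_n.+2 := fun i => (0 < i < n.+1)%N.

Definition MH (k : nat) : zmodType :=
  tuple_homology mag_gen inner_position k.

Definition EMH (k : nat) : zmodType :=
  tuple_homology eulerian_mag_gen inner_position k.

End Magnitude.

Section Poset.
Context {d : Order.disp_t} (Q : finPOrderType d).

Definition is_chain (c : seq Q) : bool := sorted <%O c.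

Definition maximal_chain (c : seq Q) : Prop :=
  is_chain c /\ forall c', is_chain c' -> {subset c <= c'} -> c' = c.

Definition ranked (n : nat) : Prop :=
  forall c, maximal_chain c -> size c = n.+1.

Definition covered (a b : Q) : bool :=
  (a < b)%O && ~~ [exists c : Q, (a < c < b)%O].

Definition hasse : rel Q := fun a b => covered a b || covered b a.

Definition chain_tuple n (t : n.+1.-tuple Q) : bool := is_chain t.

Definition any_position n : pred 'I_n.+2 := xpredT.

Definition H_order_complex (k : nat) : zmodType :=
  tuple_homology chain_tuple any_position k.

Definition reduced_H_order_complex (k : nat) : zmodType :=
  reduced_tuple_homology chain_tuple any_position k.

End Poset.

Inductive hat (T : Type) := hat0 | hat_in of T | hat1.
Arguments hat0 {T}.
Arguments hat1 {T}.

Definition hat_encode T (x : hat T) : option (option T) :=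
  match x with hat0 => None | hat_in y => Some (Some y) | hat1 => Some None end.
Definition hat_decode T (x : option (option T)) : hat T :=
  match x with None => hat0 | Some (Some y) => hat_in y | Some None => hat1 end.
Lemma hat_encodeK T : cancel (@hat_encode T) (@hat_decode T).
Proof. by case. Qed.

HB.instance Definition _ (T : finType) :=
  Finite.copy (hat T) (can_type (@hat_encodeK T)).

Section HatOrder.
Context {d : Order.disp_t} (Q : finPOrderType d).

Definition hat_le (x y : hat Q) : bool :=
  match x, y with
  | hat0, _ | _, hat1 => true
  | hat_in a, hat_in b => (a <= b)%O
  | _, _ => false
  end.

Lemma hat_le_refl : reflexive hat_le.
Proof. by case=> //= x. Qed.

Lemma hat_le_anti : antisymmetric hat_le.
Proof. by case=> [|x|] [|y|] //= /le_anti ->. Qed.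

Lemma hat_le_trans : transitive hat_le.
Proof. by case=> [|y|] [|x|] [|z|] //=; exact: le_trans. Qed.

HB.instance Definition _ := Order.Le_isPOrder.Build d (hat Q)
  hat_le_refl hat_le_anti hat_le_trans.

End HatOrder.

Local Open Scope classical_set_scope.

Section Disks.
Variables (R : realType) (n : nat).

Definition closed_disk : set 'rV[R]_n := [set x | \sum_i x 0 i ^+ 2 <= 1].
Definition open_disk : set 'rV[R]_n := [set x | \sum_i x 0 i ^+ 2 < 1].
Definition unit_sphere : set 'rV[R]_n := [set x | \sum_i x 0 i ^+ 2 = 1].

End Disks.

Arguments closed_disk : clear implicits.
Arguments open_disk : clear implicits.
Arguments unit_sphere : clear implicits.

Definition homeo_on (S T : topologicalType) (A : set S) (f : S -> T) : Prop :=
  {within A, continuous f} /\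
  exists2 g : T -> S, {within f @` A, continuous g} &
                      (forall x, A x -> g (f x) = x).

(* Compactness of the closed disk and the Hausdorff axiom make the image of the
   closed disk the closure of the open cell.  Open cells are never empty, since
   the open disk contains the origin (also in dimension 0). *)
Record cw_complex (R : realType) (X : topologicalType) := CWComplex {
  cell : Type;
  cell_dim : cell -> nat;
  char_map : forall c : cell, 'rV[R]_(cell_dim c) -> X;
  open_cell := fun c : cell => @char_map c @` open_disk R (cell_dim c);
  cw_hausdorff : hausdorff_space X;
  char_map_continuous : forall c : cell,
    {within closed_disk R (cell_dim c), continuous (@char_map c)};
  char_map_homeo : forall c : cell,
    homeo_on (open_disk R (cell_dim c)) (@char_map c);
  open_cell_disjoint : trivIset setT open_cell;
  open_cell_cover : \bigcup_(c in setT) open_cell c = setT;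
  closure_finite : forall c : cell, exists D : set cell,
    [/\ finite_set D, (forall c', D c' -> (cell_dim c' < cell_dim c)%N) &
        @char_map c @` unit_sphere R (cell_dim c)
          `<=` \bigcup_(c' in D) open_cell c'];
  weak_topology : forall A : set X,
    (forall c : cell,
       closed (A `&` @char_map c @` closed_disk R (cell_dim c))) -> closed A
}.

Arguments char_map {R X} _ _ _.

Section FacePoset.
Variables (R : realType) (X : topologicalType) (K : cw_complex R X).

Definition regular_cw : Prop :=
  forall c : cell K, homeo_on (closed_disk R (cell_dim c)) (char_map K c).

Definition finite_dimensional : Prop :=
  exists N, forall c : cell K, (cell_dim c <= N)%N.

Definition finitely_many_cells_in_each_dim : Prop :=
  forall n, finite_set [set c : cell K | cell_dim c = n].

Definition cell_closures : set (set X) :=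
  [set closure (open_cell c) | c in [set: cell K]].

Lemma finite_cell_closures :
  finite_dimensional -> finitely_many_cells_in_each_dim ->
  finite_set cell_closures.
Proof.
move=> [N dimN] fin; apply: finite_image.
apply: (@sub_finite_set _ _
  (\bigcup_(n in `I_N.+1) [set c : cell K | cell_dim c = n])).
  by move=> c _; exists (cell_dim c) => //=; rewrite ltnS.
by apply: bigcup_finite; [exact: finite_II | move=> n _; exact: fin].
Qed.

(* [fset_set A] is A when A is finite (see [finite_cell_closures]), and fset0
   otherwise; the order is inclusion, inherited from [set X]. *)
Definition face_poset : Type := fset_set cell_closures.

HB.instance Definition _ := SubFinite.on face_poset.
HB.instance Definition _ :=
  [SubChoice_isSubPOrder of face_poset by <: with set_display].

Lemma face_poset_leE (x y : face_poset) :
  (x <= y)%O = (val x `<=` val y) :> Prop.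
Proof. by rewrite -subsetEset. Qed.

End FacePoset.

(* Main.v *)
(** All saturated chains of a ranked bounded finite poset between two given
    elements have the same length, so there is a rank function increasing by
    one along covers.  A step of a walk in the Hasse diagram changes the rank
    by one, hence [rk b <= rk a + d(a, b)], with equality only if [a <= b]; so
    the k-paths from bottom to top whose length is the rank are exactly the
    chains from bottom to top, and all of them are Eulerian.  Dropping the two
    end points identifies these chains with the chains of the face poset, the
    single chain [0 < 1] playing the role of the augmentation, and, because of
    the shift of positions by one, turns the magnitude differential into minus
    the simplicial one. *)
From HB Require Import structures.
Require Import Defs.
From mathcomp Require Import all_boot all_order all_algebra.
From mathcomp Require Import all_classical all_reals all_analysis.

Set Implicit Arguments.
Unset Strict Implicit.
Unset Printing Implicit Defensive.

Import Order.TTheory GRing.Theory.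

(** * Isomorphisms of quotients and of homology groups *)

Section HomologyIsomorphism.
Local Open Scope ring_scope.
Local Open Scope quotient_scope.

Lemma zmod_isomorphic_sym (A B : zmodType) :
  zmod_isomorphic A B -> zmod_isomorphic B A.
Proof.
move=> [f [g fK gK]].
have g_additive : zmod_morphism g.
  by move=> x y; apply: (can_inj fK); rewrite raddfB !gK.
pose gM := GRing.isZmodMorphism.Build B A g g_additive.
by exists (HB.pack_for {additive B -> A} g gM); exists f.
Qed.

Lemma quot_isomorphic (U V : zmodType) (I : zmodClosed U) (J : zmodClosed V)
    (h : {additive U -> V}) :
    bijective h -> (forall y, (h y \in J) = (y \in I)) ->
  zmod_isomorphic (Quotient.quot I) (Quotient.quot J).
Proof.
move=> [h' hK h'K] hIJ.
pose H (q : Quotient.quot I) : Quotient.quot J :=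
  \pi_(Quotient.quot J) (h (repr q)).
(* [H] is defined through representatives; this shows that their choice does not matter. *)
have Hpi y : H (\pi_(Quotient.quot I) y) = \pi_(Quotient.quot J) (h y).
  by apply/eqP; rewrite -Quotient.idealrBE -raddfB hIJ Quotient.idealrBE reprK.
have H_additive : zmod_morphism H.
  by elim/quotW=> x; elim/quotW=> y; rewrite -raddfB !Hpi !raddfB.
pose HM := GRing.isZmodMorphism.Build _ _ H H_additive.
exists (HB.pack_for {additive Quotient.quot I -> Quotient.quot J} H HM).
exists (fun q => \pi_(Quotient.quot I) (h' (repr q))) => /=; elim/quotW=> y /=.
  rewrite Hpi; apply/eqP; rewrite -Quotient.idealrBE -hIJ raddfB h'K.
  by rewrite Quotient.idealrBE reprK.
by rewrite Hpi h'K reprK.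
Qed.

(** Asking that [h] match kernels and images, rather than that squares commute, absorbs the sign of
    the differential and lets [C] and [C'] be unrelated, as happens in degree 0. *)
Lemma homology_isomorphic (A B C A' B' C' : zmodType)
    (f : {additive A -> B}) (g : {additive B -> C})
    (f' : {additive A' -> B'}) (g' : {additive B' -> C'})
    (h : {additive B -> B'}) :
    bijective h ->
    (forall y, g' (h y) = 0 <-> g y = 0) ->
    (forall y, (exists x', f' x' = h y) <-> (exists x, f x = y)) ->
  zmod_isomorphic (homology f g) (homology f' g').
Proof.
move=> [h' hK h'K] h_ker h_im.
have hZ (y : cycles g) : h (val y) \in cycle_pred g'.
  by rewrite inE; apply/eqP/h_ker/eqP; exact: (valP y).
have h'Z (y : cycles g') : h' (val y) \in cycle_pred g.
  by rewrite inE; apply/eqP/h_ker; rewrite h'K; apply/eqP/(valP y).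
pose hc (y : cycles g) : cycles g' := Sub (h (val y)) (hZ y).
pose hc' (y : cycles g') : cycles g := Sub (h' (val y)) (h'Z y).
have hc_additive : zmod_morphism hc.
  by move=> x y; apply: val_inj; rewrite /= !raddfB.
pose hcM := GRing.isZmodMorphism.Build _ _ hc hc_additive.
pose hcA := HB.pack_for {additive cycles g -> cycles g'} hc hcM.
apply: (@quot_isomorphic _ _ _ _ hcA).
  by exists hc' => y; apply: val_inj; rewrite /= ?hK ?h'K.
by move=> y; rewrite !inE; apply/asboolP/asboolP => /h_im.
Qed.

End HomologyIsomorphism.

(** * Additive maps out of free abelian groups *)

Section FreeAbelian.
Local Open Scope ring_scope.

Lemma linext_basis (S : finType) (M : zmodType) (m : S -> M) (s : S) :
  linext m (basis_elt s) = m s.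
Proof.
rewrite /linext (bigD1 s) //= ffunE eqxx mulr1z big1 ?addr0// => t ts.
by rewrite ffunE (negbTE ts) mulr0z.
Qed.

Lemma free_abelian_sum (S : finType) (c : free_abelian S) :
  c = \sum_s basis_elt s *~ c s.
Proof.
apply/ffunP => t; rewrite sum_ffunE (bigD1 t) //= big1 => [|s st].
  by rewrite addr0 ffunMzE ffunE eqxx intz.
by rewrite ffunMzE ffunE eq_sym (negPf st) mul0rz.
Qed.

Lemma eq_on_basis (S : finType) (M : zmodType)
    (f g : {additive free_abelian S -> M}) :
  (forall s, f (basis_elt s) = g (basis_elt s)) -> f =1 g.
Proof.
move=> fg c; rewrite (free_abelian_sum c) !raddf_sum.
by apply: eq_bigr => s _; rewrite !raddfMz fg.
Qed.

Definition free_map (S T : finType) (i : S -> T) :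
    {additive free_abelian S -> free_abelian T} :=
  linext (fun s => basis_elt (i s)).

Lemma free_map_basis (S T : finType) (i : S -> T) (s : S) :
  free_map i (basis_elt s) = basis_elt (i s).
Proof. exact: linext_basis. Qed.

Lemma free_map_cancel (S T : finType) (i : S -> T) (j : T -> S) :
  cancel i j -> cancel (free_map i) (free_map j).
Proof.
move=> iK c; have := @eq_on_basis _ _ (free_map j \o free_map i) idfun.
by apply=> s /=; rewrite !free_map_basis iK.
Qed.

End FreeAbelian.

(** * Saturated chains and the rank function *)

Section RankFunction.
Context {d : Order.disp_t} (P : finPOrderType d).
Local Open Scope order_scope.

Lemma covered_lt (a b : P) : covered a b -> a < b.
Proof. by case/andP. Qed.

(** Induction on the size of the interval: an element [c] strictly between [a] and [b] splits off
    two smaller intervals, one missing [b] and the other missing [a]. *)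
Lemma covered_path_le (a b : P) : a <= b ->
  exists2 p, path (@covered _ P) a p & last a p = b.
Proof.
have [n] := ubnP #|[pred c | a <= c <= b]|; elim: n a b => // n IHn a b le_n.
rewrite le_eqVlt => /predU1P[<-|ab]; first by exists [::].
have [cov|] := boolP (covered a b); first by exists [:: b]; rewrite //= cov.
rewrite /covered ab negbK => /existsP[c /andP[ac cb]].
have [|p ap pc] := IHn a c _ (ltW ac).
  rewrite -ltnS; apply: leq_trans le_n; rewrite ltnS; apply: proper_card.
  apply/properP; split.
    apply/fintype.subsetP => z; rewrite !inE => /andP[-> zc] /=.
    exact: le_trans (ltW cb).
  by exists b; rewrite inE ?(ltW ab) ?lexx //= lt_geF ?andbF.
have [|q cq qb] := IHn c b _ (ltW cb).
  rewrite -ltnS; apply: leq_trans le_n; rewrite ltnS; apply: proper_card.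
  apply/properP; split.
    apply/fintype.subsetP => z; rewrite !inE => /andP[cz ->].
    by rewrite (le_trans (ltW ac)).
  by exists a; rewrite inE ?(ltW ab) ?lexx //= lt_geF.
by exists (p ++ q); rewrite ?cat_path ?last_cat ?pc // ap cq.
Qed.

Lemma chain_comparable (c : seq P) : is_chain c ->
  {in c &, forall x y, x >=< y}.
Proof.
elim: c => // a c IHc; rewrite /is_chain /= (path_sortedE lt_trans).
move=> /andP[/allP ac /IHc cc] x y; rewrite !inE.
case/predU1P=> [->|xc] /predU1P[->|yc]; first exact: comparablexx.
- exact/lt_comparable/ac.
- exact/gt_comparable/ac.
- exact: cc.
Qed.

(** A saturated chain cannot be refined: [z] is followed up the path until it lies strictly below
    the next vertex [b], and then the cover of [a] by [b] leaves only [z = a]. *)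
Lemma covered_path_full (a z : P) (p : seq P) :
    path (@covered _ P) a p -> a <= z <= last a p ->
    {in p, forall y, y >=< z} ->
  z \in a :: p.
Proof.
elim: p a => [|b p IHp] a /=; first by move=> _ /le_anti->; rewrite inE.
case/andP=> /andP[_ noz] bp /andP[az zp] cmp.
have [bz|zb] := comparable_leP (cmp b (mem_head _ _)).
  rewrite inE IHp ?orbT ?bz // => y yp; apply: cmp.
  by rewrite inE yp orbT.
move: az; rewrite le_eqVlt inE eq_sym => /predU1P[->|az]; first by rewrite eqxx.
by case/existsP: noz; exists z; rewrite az.
Qed.

(** Every element of a larger chain is comparable with all of [p], so it already lies on the
    path. *)
Lemma covered_path_maximal (a : P) (p : seq P) :
    (forall x, a <= x <= last a p) -> path (@covered _ P) a p ->
  maximal_chain (a :: p).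
Proof.
move=> bnd ap; split; first exact: (sub_path covered_lt).
move=> c cc pc; apply: (irr_sorted_eq lt_trans ltxx) => //.
  exact: (sub_path covered_lt).
move=> z; apply/idP/idP => [zc|/pc//].
apply: covered_path_full => // y yp.
by apply: (chain_comparable cc) => //; apply: pc; rewrite inE yp orbT.
Qed.

(** The rank of [x] is the length of a chosen saturated chain from [bot] to [x]. The choice does not
    matter, because a common continuation to [top] always gives total length [r]. *)
Lemma rank_function (bot top : P) (r : nat) :
    (forall x, bot <= x) -> (forall x, x <= top) -> ranked P r ->
  exists rk : P -> nat, [/\ rk bot = 0, rk top = r &
    forall x y, covered x y -> rk y = (rk x).+1]%N.
Proof.
move=> le_bot le_top rkP.
have size_path p : path (@covered _ P) bot p -> last bot p = top ->
    size p = r.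
  (* [ranked] counts [r.+1] vertices, while [p] leaves out [bot]. *)
  move=> botp ptop; apply: succn_inj; apply: (rkP (bot :: p)).
  by apply: covered_path_maximal => // x; rewrite le_bot ptop le_top.
have path_eq p q : path (@covered _ P) bot p -> path (@covered _ P) bot q ->
    last bot p = last bot q -> size p = size q.
  move=> botp botq pq.
  have [s sp stop] := covered_path_le (le_top (last bot p)).
  apply: (@addIn (size s)); rewrite -!size_cat !size_path //.
  - by rewrite cat_path botq -pq.
  - by rewrite last_cat -pq.
  - by rewrite cat_path botp.
  - by rewrite last_cat.
have /choice[f fP] x : exists p, path (@covered _ P) bot p /\ last bot p = x.
  by have [p ? ?] := covered_path_le (le_bot x); exists p.
exists (size \o f); split=> [||x y xy] /=.
- by have [? ?] := fP bot; rewrite (path_eq _ [::]).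
- by have [? ?] := fP top; exact: size_path.
have [? lx] := fP x; have [? ly] := fP y.
rewrite (path_eq _ (rcons (f x) y)) ?size_rcons ?last_rcons //.
by rewrite rcons_path lx xy andbT.
Qed.

End RankFunction.

(** * Distances in the Hasse diagram and paths of minimal length *)

Section GeodesicsAreChains.
Context {d : Order.disp_t} (P : finPOrderType d) (rk : P -> nat).
Hypothesis rk_covered : forall x y : P, covered x y -> rk y = (rk x).+1.

(** The equality case is carried through the induction: a single step down leaves the bound at least
    two short. *)
Lemma hasse_path_rank (a : P) (p : seq P) : path (@hasse _ P) a p ->
  rk (last a p) <= rk a + size p ?= iff path (@covered _ P) a p.
Proof.
elim: p a => [|b p IHp] a /=; first by rewrite addn0; split; rewrite ?eqxx.
case/andP=> ab /IHp{IHp}[le_bp eq_bp].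
have [cov|ncov] := boolP (covered a b).
  by rewrite addnS -addSn -(rk_covered cov); split.
have /rk_covered rka : covered b a by move: ab; rewrite /hasse (negPf ncov).
split; first by rewrite rka (leq_trans le_bp) // leq_add.
apply/negbTE; rewrite neq_ltn (leq_ltn_trans le_bp)//.
by rewrite rka addSn addnS ltnS ltnW.
Qed.

Lemma covered_path_last_le (a : P) (p : seq P) :
  path (@covered _ P) a p -> (a <= last a p)%O.
Proof.
elim: p a => //= b p IHp a /andP[/covered_lt/ltW ab /IHp]; exact: le_trans.
Qed.

Lemma has_walk_dist (V : finType) (e : rel V) (a b : V) (n : nat) :
  dist e a b = Some n -> has_walk e a b n.
Proof. by rewrite /dist; case: pselect => // ex [<-]; case: ex_minnP. Qed.

Lemma dist_eq (V : finType) (e : rel V) (a b : V) (n : nat) :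
    has_walk e a b n -> (forall m, has_walk e a b m -> n <= m) ->
  dist e a b = Some n.
Proof.
move=> walk_n min_n; rewrite /dist; case: pselect => [ex|[]]; last by exists n.
case: ex_minnP => m /min_n nm /(_ n walk_n) mn.
by congr Some; apply/eqP; rewrite eqn_leq mn.
Qed.

Lemma dist_rank (a b : P) (n : nat) : dist (@hasse _ P) a b = Some n ->
  rk b <= rk a + n /\ (rk b = rk a + n -> (a <= b)%O).
Proof.
move=> /has_walk_dist/existsP[p /andP[ap /eqP<-]].
have [] := hasse_path_rank ap; rewrite size_tuple => le_p eq_p; split=> //.
by move=> /eqP; rewrite eq_p => /covered_path_last_le.
Qed.

(** A saturated chain from [a] to [b] is a walk whose length is the rank difference, and no walk is
    shorter since each step gains at most one. *)
Lemma dist_lt (a b : P) : (a < b)%O ->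
  exists2 n, dist (@hasse _ P) a b = Some n & rk b = rk a + n.
Proof.
move=> /ltW/covered_path_le[p ap pb].
have hp : path (@hasse _ P) a p.
  by apply: sub_path ap => x y; rewrite /hasse => ->.
have [_ /esym] := hasse_path_rank hp; rewrite ap pb => /esym/eqP rkb.
exists (size p) => //; apply: dist_eq => [|m /existsP[q /andP[aq /eqP qb]]].
  by apply/existsP; exists (in_tuple p); rewrite /= hp pb eqxx.
by have [+ _] := hasse_path_rank aq; rewrite qb rkb leq_add2l size_tuple.
Qed.

Lemma path_length_cons (V : finType) (e : rel V) (a b : V) (s : seq V) :
  path_length e [:: a, b & s] = odflt 0 (dist e a b) + path_length e (b :: s).
Proof. by rewrite /path_length /= big_cons. Qed.

(** The bounds of [dist_rank] add up over the steps; equality in the sum forces equality in each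
    step, so every step goes up. *)
Lemma kpath_rank (a : P) (s : seq P) : is_kpath (@hasse _ P) (a :: s) ->
  rk (last a s) <= rk a + path_length (@hasse _ P) (a :: s) /\
  (rk (last a s) = rk a + path_length (@hasse _ P) (a :: s) -> path <%O a s).
Proof.
rewrite /is_kpath /=; elim: s a => [|b s IHs] a /=.
  by move=> _; split=> //; exact: leq_addr.
case/andP=> /andP[ab]; case dab : dist => [n|] // _ /IHs[le_s eq_s].
have [le_b eq_b] := dist_rank dab.
rewrite path_length_cons dab /= addnA; split=> [|rk_s].
  by apply: leq_trans le_s _; rewrite leq_add2r.
(* The tail gains at most its own length, so the first step must gain all of [n]. *)
have rkb : rk b = rk a + n.
  apply/eqP; rewrite eqn_leq le_b.
  by rewrite -(leq_add2r (path_length (@hasse _ P) (b :: s))) -rk_s.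
by rewrite lt_neqAle ab eq_b //= eq_s // rk_s rkb.
Qed.

Lemma chain_rank (a : P) (s : seq P) : path <%O a s ->
  is_kpath (@hasse _ P) (a :: s) /\
  rk (last a s) = rk a + path_length (@hasse _ P) (a :: s).
Proof.
rewrite /is_kpath /=; elim: s a => [|b s IHs] a /=.
  by rewrite /path_length big_nil addn0.
case/andP=> ab /IHs[-> ->]; have [n dab rkb] := dist_lt ab.
by rewrite path_length_cons dab /= rkb addnA lt_eqF.
Qed.

(** The common generators of both magnitude complexes once [l] is the rank difference of [a] and
    [b]. *)
Definition spanning_chain (a b : P) (n : nat) (t : n.+1.-tuple P) : bool :=
  [&& is_chain t, thead t == a & last a t == b].

(** Stated as an equality of predicates, so that the resulting homology groups are equal and not
    merely isomorphic. *)
Lemma mag_gen_rank (a b : P) (n l : nat) : rk b = rk a + l ->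
  @mag_gen _ (@hasse _ P) l a b n = @spanning_chain a b n.
Proof.
move=> rkb; apply/funext => t; case/tupleP: t => x t.
rewrite /mag_gen /spanning_chain theadE /is_chain /=.
apply/and4P/and3P => [[kp /eqP len xa tb]|[xt xa tb]]; split=> //.
  have [_] := kpath_rank kp; apply.
  by rewrite len (eqP tb) (eqP xa).
all: have [kp len] := chain_rank xt => //.
by rewrite -(eqn_add2l (rk a)) -rkb -(eqP tb) len (eqP xa).
Qed.

Lemma eulerian_mag_gen_rank (a b : P) (n l : nat) : rk b = rk a + l ->
  @eulerian_mag_gen _ (@hasse _ P) l a b n = @spanning_chain a b n.
Proof.
move=> rkb; apply/funext => t; rewrite /eulerian_mag_gen (mag_gen_rank _ rkb).
apply: andb_idr => /and3P[ch _ _].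
exact: (sorted_uniq lt_trans ltxx).
Qed.

End GeodesicsAreChains.

(** * Chains from bottom to top of the extended poset *)

Section HatChains.
Context {d : Order.disp_t} (Q : finPOrderType d).

Lemma hat_in_lt (x y : Q) : (hat_in x < hat_in y)%O = (x < y)%O.
Proof. by rewrite !lt_neqAle. Qed.

Lemma hat_in_lt1 (x : Q) : (hat_in x < hat1 :> hat Q)%O.
Proof. by rewrite lt_neqAle. Qed.

Definition unhat (x : hat Q) : option Q :=
  if x is hat_in y then Some y else None.

Lemma unhatK : ocancel unhat (@hat_in Q).
Proof. by case. Qed.

(** List form of the deletion, in which the added end points can be computed with. *)
Lemma delete_at_val (V : finType) n (i : 'I_n.+2) (t : n.+2.-tuple V) :
  delete_at i t = take i t ++ drop i.+1 t :> seq V.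
Proof.
have x0 : V := tnth t i.
have le_i : i <= n.+1 by rewrite -ltnS.
apply: (@eq_from_nth _ x0) => [|j].
  rewrite size_tuple size_cat size_drop size_take size_tuple ltnS le_i.
  by rewrite subSS subnKC.
rewrite size_tuple => lt_j; pose j' := Ordinal lt_j.
rewrite -[LHS](tnth_nth x0 (delete_at i t) j') tnth_mktuple (tnth_nth x0) /=.
rewrite nth_cat size_take size_tuple ltnS le_i /bump.
case: ltnP => ji; first by rewrite nth_take // add0n.
by rewrite nth_drop add1n addSn subnKC.
Qed.

Lemma delete_at_chain n (i : 'I_n.+2) (t : n.+2.-tuple Q) :
  is_chain t -> is_chain (delete_at i t).
Proof.
rewrite /is_chain; apply: (subseq_sorted lt_trans); rewrite delete_at_val.
rewrite -[X in subseq _ X](cat_take_drop i) cat_subseq //.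
by rewrite -add1n -drop_drop drop_subseq.
Qed.

Definition hat_tuple n (t : n.-tuple Q) : n.+2.-tuple (hat Q) :=
  [tuple of hat0 :: rcons [tuple of map (@hat_in Q) t] hat1].

Lemma hat_tuple_chain n (t : n.-tuple Q) :
  is_chain t -> spanning_chain hat0 hat1 (hat_tuple t).
Proof.
rewrite /spanning_chain /hat_tuple theadE /is_chain /= last_rcons !eqxx !andbT.
case: {n t}(val t) => /= [|x t xt] //.
rewrite rcons_path last_map hat_in_lt1 andbT path_map.
by apply: sub_path xt => y z /=; rewrite hat_in_lt.
Qed.

Lemma hat_tuple_surj n (t : n.+2.-tuple (hat Q)) :
    spanning_chain hat0 hat1 t ->
  exists2 s : n.-tuple Q, is_chain s & hat_tuple s = t.
Proof.
move=> span_t; suff [s s_chain /val_inj st] : exists2 s : n.-tuple Q,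
    is_chain s & hat_tuple s = t :> seq _ by exists s.
move: span_t; case/tupleP: t => x t.
rewrite /spanning_chain theadE /is_chain /=.
case/and3P=> xt /eqP x0; move: xt; rewrite {}x0.
case: t => t /= sz_t; case/lastP: t sz_t => // t y; rewrite /= last_rcons.
move=> sz_t chain_t /eqP y1; subst y.
(* Strictness puts each inner entry strictly between [hat0] and [hat1], hence in [Q], and
   [pmap unhat] recovers the chain. *)
have all_t : all unhat t.
  apply/allP => z zt; move: chain_t.
  rewrite (path_sortedE lt_trans) all_rcons (sorted_pairwise lt_trans).
  rewrite pairwise_rcons.
  case/andP=> /andP[_ /allP/(_ _ zt) z0] /andP[/allP/(_ _ zt) z1 _].
  by case: z z0 z1 {zt}.
have tE : [seq hat_in i | i <- pmap unhat t] = t.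
  by rewrite (pmap_filter unhatK) (all_filterP all_t).
have sz : size (pmap unhat t) == n.
  by move: sz_t; rewrite size_rcons eqSS -{1}tE size_map.
exists (Tuple sz); last by rewrite /= tE.
move: chain_t; rewrite rcons_path -{1}tE /is_chain /=; case/andP=> /path_sorted + _.
by rewrite sorted_map; apply: sub_sorted => y z /=; rewrite hat_in_lt.
Qed.

Lemma delete_at_hat_tuple n (i : 'I_n.+3) (j : 'I_n.+1) (t : n.+1.-tuple Q) :
    i = j.+1 :> nat ->
  delete_at i (hat_tuple t) =
  hat0 :: rcons (map (@hat_in Q) (take j t ++ drop j.+1 t)) hat1 :> seq (hat Q).
Proof.
move=> ij; rewrite delete_at_val ij /= -!cats1 takel_cat; last first.
  by rewrite size_tuple ltnW.
rewrite drop_cat size_tuple map_cat map_take map_drop -catA.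
(* If [j] is the last position of [t], dropping past it leaves only [hat1]. *)
case: ltnP => // le_j.
have -> : j = n :> nat by apply/eqP; rewrite eqn_leq -ltnS ltn_ord.
by rewrite subnn drop0 [drop n.+1 _]drop_oversize // size_tuple.
Qed.

(** * Comparison of the two chain complexes *)

Local Notation genQ := (gens (@chain_tuple _ Q)).
Local Notation genH := (gens (@spanning_chain _ (hat Q) hat0 hat1)).
Local Notation bdQ := (bd (@chain_tuple _ Q) any_position).
Local Notation bdH :=
  (bd (@spanning_chain _ (hat Q) hat0 hat1) inner_position).

Definition hat_gen n (s : genQ n) : genH n.+2 :=
  Sub (hat_tuple (val s)) (hat_tuple_chain (valP s)).

Lemma hat_gen_bij n : bijective (@hat_gen n).
Proof.
have inj : injective (@hat_gen n).
  move=> s t /(congr1 val)/(congr1 val)/= -[] /rcons_inj[].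
  move/inj_map => st; apply: val_inj; apply: val_inj; apply: st.
  by move=> x y [].
have ex (t : genH n.+2) : exists s : genQ n, hat_gen s = t.
  have [s s_chain st] := hat_tuple_surj (valP t).
  by exists (Sub s s_chain); apply: val_inj.
have /choice[g gK] := ex.
by exists g => // s; apply: inj; rewrite gK.
Qed.

Local Open Scope ring_scope.

Local Notation hat_map n := (free_map (@hat_gen n)).

(** Both deletions give chains again, so neither side falls into the zero case of [face]. *)
Lemma face_hat n (i : 'I_n.+4) (j : 'I_n.+2) (s : genQ n.+1) :
    i = j.+1 :> nat ->
  face i (hat_gen s) = hat_map n (face j s).
Proof.
move=> ij; have chain_s : chain_tuple (delete_at j (val s)).
  by apply: delete_at_chain; exact: (valP s).
have dE : delete_at i (hat_tuple (val s)) = hat_tuple (delete_at j (val s)).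
  by apply: val_inj; rewrite [LHS](delete_at_hat_tuple _ ij) -delete_at_val.
rewrite /face (insubT _ chain_s) /= free_map_basis dE.
by rewrite (insubT _ (hat_tuple_chain chain_s)).
Qed.

Lemma bd_hat n (c : free_abelian (genQ n.+1)) :
  bdH n.+2 (hat_map n.+1 c) = - hat_map n (bdQ n c).
Proof.
rewrite -raddfN.
have := @eq_on_basis _ _ (bdH n.+2 \o hat_map n.+1)
  (hat_map n \o (-%R \o bdQ n)).
apply=> s /=; rewrite free_map_basis /bd !linext_basis raddfN.
rewrite (raddf_sum (hat_map n)).
(* The two end positions are not inner and drop out; the others are the [j.+1], whence one extra
   sign. *)
rewrite big_mkcond big_ord_recl big_ord_recr /= add0r.
rewrite [inner_position (lift _ _)]/inner_position /= ltnn addr0 -sumrN.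
apply: eq_bigr => j _.
rewrite (@face_hat _ _ j) // raddfMz /= exprS mulN1r mulrNz.
by rewrite /inner_position /= ltnS ltn_ord.
Qed.

(** Deleting the middle entry of any chain [hat0 < x < hat1] leaves the same chain [u], with sign
    -1; so the boundary is the coefficient sum times [- basis_elt u]. *)
Lemma bd_hat_augmentation (c : free_abelian (genQ 0)) :
  bdH 1 (hat_map 0 c) = 0 <->
  linext (fun _ : genQ 0 => 1 : int) c = 0.
Proof.
have span01 : @spanning_chain _ (hat Q) hat0 hat1 1 [tuple hat0; hat1].
  by rewrite /spanning_chain theadE /is_chain /= !eqxx.
pose u : genH 1 := Sub _ span01.
suff -> : bdH 1 (hat_map 0 c)
    = (- basis_elt u) *~ linext (fun _ : genQ 0 => 1 : int) c.
  (* Evaluation at [u] recovers the coefficient sum up to sign. *)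
  split=> [/ffunP/(_ u)|->]; last by rewrite mulr0z.
  by rewrite ffunMzE !ffunE eqxx mulNrz intz => /eqP; rewrite oppr_eq0 => /eqP.
have := @eq_on_basis _ _ (bdH 1 \o hat_map 0)
  (intmul (- basis_elt u) \o linext (fun _ : genQ 0 => 1 : int)).
apply=> s /=; rewrite free_map_basis /bd !linext_basis.
rewrite big_mkcond !big_ord_recl big_ord0 /= add0r !addr0 expr1 mulrN1z mulr1z.
congr (- _); rewrite /face; set t := delete_at _ _.
have -> : t = [tuple hat0; hat1].
  apply: val_inj; rewrite [LHS](@delete_at_hat_tuple _ _ ord0) //= take0.
  by rewrite drop_oversize // size_tuple.
by rewrite (insubT _ span01).
Qed.

(** The maps [hat_map] are bijective and commute with the differentials up to sign, so they match
    cycles and boundaries; the shift by two counts the added end points. *)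
Lemma hat_homology_isomorphic k :
  zmod_isomorphic
    (reduced_tuple_homology (@chain_tuple _ Q) any_position k)
    (tuple_homology (@spanning_chain _ (hat Q) hat0 hat1) inner_position k.+2).
Proof.
have im n y :
    (exists x', bdH n.+2 x' = hat_map n y) <-> (exists x, bdQ n x = y).
  have [g gK Kg] := hat_gen_bij n.
  have [g1 g1K Kg1] := hat_gen_bij n.+1.
  split=> [[x']|[x <-]]; last first.
    by exists (hat_map n.+1 (- x)); rewrite bd_hat !raddfN opprK.
  rewrite -(free_map_cancel Kg1 x') bd_hat -raddfN.
  move=> /(can_inj (free_map_cancel gK)) <-.
  by exists (- free_map g1 x'); rewrite raddfN.
have bij n : bijective (hat_map n).
  have [g gK Kg] := hat_gen_bij n.
  by exists (free_map g); exact: free_map_cancel.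
(* For [k = 0] the cycles are the kernel of the augmentation, otherwise that of the simplicial
   differential. *)
case: k => [|k]; apply: homology_isomorphic (bij _) _ (im _) => y.
  exact: bd_hat_augmentation.
rewrite bd_hat; split=> [/eqP|->]; last by rewrite !raddf0.
rewrite oppr_eq0 => /eqP; rewrite -[RHS](raddf0 (hat_map k)).
exact: (bij_inj (bij _)).
Qed.

Lemma ranked_hat_magnitude_homology r k : ranked (hat Q) r ->
  EMH (@hasse _ (hat Q)) r hat0 hat1 k
    = tuple_homology (@spanning_chain _ (hat Q) hat0 hat1) inner_position k /\
  MH (@hasse _ (hat Q)) r hat0 hat1 k
    = tuple_homology (@spanning_chain _ (hat Q) hat0 hat1) inner_position k.
Proof.
move=> /(@rank_function _ _ hat0 hat1)[//|[]//|rk [rk0 rk1 rk_cov]].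
have rkE : rk hat1 = (rk hat0 + r)%N by rewrite rk0 rk1.
rewrite /EMH /MH; split; congr (tuple_homology _ _ _);
  apply: functional_extensionality_dep => n.
  by have := eulerian_mag_gen_rank rk_cov n rkE.
by have := mag_gen_rank rk_cov n rkE.
Qed.

End HatChains.

(** Reduced homology is what fits every degree: the path from [hat0] directly to [hat1] sits in
    degree 1 of the magnitude complex and makes the next differential an augmentation. *)
Theorem theorem6p4 (R : realType) (X : topologicalType) (K : cw_complex R X)
    (K_regular : regular_cw K)
    (K_finite_dim : finite_dimensional K)
    (K_finite_type : finitely_many_cells_in_each_dim K)
    (r : nat) (rk_r : ranked (hat (face_poset K)) r) (k : nat) :
  let G := @hasse _ (hat (face_poset K)) in
  let EMHk2 := EMH G r hat0 hat1 k.+2 in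
  let MHk2 := MH G r hat0 hat1 k.+2 in
  (zmod_isomorphic EMHk2 (reduced_H_order_complex (face_poset K) k) /\
   zmod_isomorphic (reduced_H_order_complex (face_poset K) k) MHk2) /\
  (0 < k ->
   zmod_isomorphic EMHk2 (H_order_complex (face_poset K) k) /\
   zmod_isomorphic (H_order_complex (face_poset K) k) MHk2).
Proof.
move=> G EMHk2 MHk2.
have [E M] := ranked_hat_magnitude_homology k.+2 rk_r.
rewrite (E : EMHk2 = _) (M : MHk2 = _) {E M EMHk2 MHk2}.
have iso := hat_homology_isomorphic (face_poset K) k.
have iso' := zmod_isomorphic_sym iso.
(* For positive [k] the reduced and ordinary groups coincide by definition. *)
by split=> //; case: k iso iso'.
Qed.
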